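(* Let $G_1$ be the graph with edges $\{1,3\},\{1,5\},\{2,3\},\{2,4\}$. Then (1) $n\log n\ll\mathrm{ex}_e(G_1,n)\ll n(\log n)^2(\log\log n)^3$; (2) $n\log n\ll\mathrm{ex}_i(G_1,n)\ll n(\log n)^2(\log\log n)^3$.
   Context: A hypergraph $H=(E_i: i\in I)$ is a finite list of finite nonempty subsets of $\mathbb{N}$; it is simple if its edges are pairwise distinct. $v(H)=|\bigcup_i E_i|$, $e(H)=|I|$, $i(H)=\sum_i|E_i|$. $H$ contains $H'=(E'_i:i\in I')$ ($H\succ H'$) if there exist an increasing injection $\phi:\bigcup H'\to\bigcup H$ and an injection $f:I'\to I$ with $v\in E'_i\Rightarrow \phi(v)\in E_{f(i)}$. $\mathrm{ex}_e(F,n)=\max\{e(H): H\not\succ F,\ H\text{ simple},\ v(H)\le n\}$, $\mathrm{ex}_i(F,n)=\max\{i(H): H\not\succ F,\ H\text{ simple},\ v(H)\le n\}$. $f\ll g$ means $|f(n)|<c|g(n)|$ for some constant $c>0$ and all large $n$. *)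

(* Defs.v *)
From HB Require Import structures.
From mathcomp Require Import all_boot all_order all_algebra.
From mathcomp Require Import finmap.
From mathcomp Require Import all_classical all_reals all_analysis.

Set Implicit Arguments.
Unset Strict Implicit.
Unset Printing Implicit Defensive.

Import Order.TTheory GRing.Theory Num.Theory.

Record hypergraph := Hypergraph {
  edges : seq {fset nat};
  edges_neq0 : fset0%fset \notin edges }.

Definition nedges (H : hypergraph) : nat := size (edges H).

Definition edge (H : hypergraph) (i : 'I_(nedges H)) : {fset nat} :=
  nth fset0%fset (edges H) i.

Definition simple (H : hypergraph) : Prop := injective (@edge H).

Definition vertices (H : hypergraph) : {fset nat} :=
  (\bigcup_(E <- edges H) E)%fset.

Definition nvertices (H : hypergraph) : nat := #|` vertices H|.

Definition nincidences (H : hypergraph) : nat :=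
  \sum_(i < nedges H) #|` edge i|.

(* Only the restriction of [phi] to [vertices H'] matters. *)
Definition contains (H H' : hypergraph) : Prop :=
  exists (phi : nat -> nat) (f : 'I_(nedges H') -> 'I_(nedges H)),
    [/\ forall v, v \in vertices H' -> phi v \in vertices H,
        {in vertices H' &, forall u v, u < v -> phi u < phi v},
        injective f
      & forall i v, v \in edge i -> phi v \in edge (f i)].

Definition is_max (A : set nat) (m : nat) : Prop :=
  A m /\ forall k, A k -> k <= m.

(* Junk value 0 when [A] has no maximum. *)
Definition max_nat (A : set nat) : nat := xget 0 [set m | is_max A m].

Definition avoiders (F : hypergraph) (n : nat) : set hypergraph :=
  [set H | [/\ ~ contains H F, simple H & nvertices H <= n]].

Definition ex_e (F : hypergraph) (n : nat) : nat :=
  max_nat [set nedges H | H in avoiders F n].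

Definition ex_i (F : hypergraph) (n : nat) : nat :=
  max_nat [set nincidences H | H in avoiders F n].

Lemma max_natP (A : set nat) (b : nat) :
  (exists k, A k) -> (forall k, A k -> k <= b) -> is_max A (max_nat A).
Proof.
move=> [k Ak] Ab.
have exA : exists k, `[< A k >] by exists k; apply/asboolP.
have ubA j : `[< A j >] -> j <= b by move/asboolP; exact: Ab.
case: (ex_maxnP exA ubA) => m /asboolP Am mA.
rewrite /max_nat; case: xgetP => [x _ //|/(_ m)[]]; split=> // j Aj.
by apply: mA; apply/asboolP.
Qed.

Lemma edge_sub_vertices (H : hypergraph) (i : 'I_(nedges H)) :
  (edge i `<=` vertices H)%fset.
Proof.
have Hi : edge i \in edges H by exact: mem_nth.
exact: (@bigfcup_sup _ _ _ _ xpredT id Hi).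
Qed.

Lemma nedges_bound (H : hypergraph) (n : nat) :
  simple H -> nvertices H <= n -> nedges H <= 2 ^ n.
Proof.
move=> sH vH.
apply: (@leq_trans (2 ^ nvertices H)); last by rewrite leq_exp2l.
rewrite -card_fpowerset.
have <- : size [seq edge i | i <- enum 'I_(nedges H)] = nedges H.
  by rewrite size_map size_enum_ord.
apply: uniq_leq_size; first by rewrite map_inj_uniq ?enum_uniq.
by move=> _ /mapP[i _ ->]; rewrite [_ \in _]fpowersetE edge_sub_vertices.
Qed.

Lemma nincidences_bound (H : hypergraph) (n : nat) :
  simple H -> nvertices H <= n -> nincidences H <= 2 ^ n * n.
Proof.
move=> sH vH; apply: (@leq_trans (nedges H * n)); last first.
  by rewrite leq_mul2r nedges_bound ?orbT.
rewrite -[X in _ <= X * _]card_ord -sum_nat_const; apply: leq_sum => i _.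
exact: leq_trans (fsubset_leq_card (edge_sub_vertices i)) vH.
Qed.

Definition hypergraph0 : hypergraph := @Hypergraph [::] isT.

Lemma avoiders_hypergraph0 (F : hypergraph) (n : nat) :
  0 < nedges F -> avoiders F n hypergraph0.
Proof.
move=> F0; split=> [[phi [f _]]|[]//|]; first by case: (f (Ordinal F0)).
by rewrite /nvertices /vertices big_nil cardfs0.
Qed.

Lemma ex_eP (F : hypergraph) (n : nat) : 0 < nedges F ->
  is_max [set nedges H | H in avoiders F n] (ex_e F n).
Proof.
move=> F0; apply: (@max_natP _ (2 ^ n)).
  by exists (nedges hypergraph0), hypergraph0 => //; exact: avoiders_hypergraph0.
by move=> _ [H [_ sH vH] <-]; exact: nedges_bound.
Qed.

Lemma ex_iP (F : hypergraph) (n : nat) : 0 < nedges F ->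
  is_max [set nincidences H | H in avoiders F n] (ex_i F n).
Proof.
move=> F0; apply: (@max_natP _ (2 ^ n * n)).
  by exists (nincidences hypergraph0), hypergraph0 => //; exact: avoiders_hypergraph0.
by move=> _ [H [_ sH vH] <-]; exact: nincidences_bound.
Qed.

Definition G1_edges : seq {fset nat} :=
  [:: [fset 1; 3]; [fset 1; 5]; [fset 2; 3]; [fset 2; 4]]%fset.

Lemma G1_edges_neq0 : fset0%fset \notin G1_edges.
Proof. by rewrite !inE !(eq_sym fset0%fset) -!cardfs_eq0 !cardfs2. Qed.

Definition G1 : hypergraph := Hypergraph G1_edges_neq0.

Definition vinogradov_ll (R : realType) (f g : nat -> R) : Prop :=
  (exists2 c : R, 0 < c & \forall n \near \oo%classic, `|f n| < c * `|g n|)%R.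

Notation "f '<<_oo' g" := (vinogradov_ll f g) (at level 70, no associativity).

(* Main.v *)
Require Import Defs.
From mathcomp Require Import all_boot all_order all_algebra.
From mathcomp Require Import finmap zify ring lra.
From mathcomp Require Import all_classical all_reals all_analysis.

(** Lower bound: on rows [i < m] and columns [m + j], join [i] to [m + j] iff
    [i - j] is a power of [2].

    Upper bound, in the stronger form [ex_i G1 n = O(n log n)].  In a G1-free
    ordered graph call a neighbour [c] of [a], to the right of [a], short if
    the gap to the next neighbour is at most half the distance to the last one.
    Short gaps double along the left neighbours of a fixed [c], and the
    distance to the last neighbour halves at each other edge from a fixed [a],
    so there are [O(n log n)] edges (Fueredi).  In a G1-free hypergraph call a
    pair low if at most three edges contain it.  The pairs that are not low form
    a G1-free graph, since distinct edges can be chosen for them greedily;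
    hence each five vertices span a low pair.  Cutting an edge into
    blocks of five consecutive vertices and choosing a low pair in each block
    again gives a G1-free graph: the four intervals of a copy of G1 share a
    point, whereas pairs chosen in one edge span disjoint intervals.
    This controls all edges but the cliques, of size at most four, of non-low
    pairs; a clique is determined by its two least vertices up to a
    subset of their at most two common right neighbours. *)

Set Implicit Arguments.
Unset Strict Implicit.
Unset Printing Implicit Defensive.

Import Order.TTheory GRing.Theory Num.Theory.

(** * Ordered graphs without [G1] *)

Definition G1_free_graph (m : nat) (P : {set 'I_m * 'I_m}) : Prop :=
  (forall u v, (u, v) \in P -> u < v) /\
  forall a b c d e : 'I_m, a < b -> c < d -> d < e ->
    (a, c) \in P -> (a, e) \in P -> (b, c) \in P -> (b, d) \in P -> False.

Lemma trunc_log2_ltn (x y : nat) :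
  0 < x -> x.*2 <= y -> trunc_log 2 x < trunc_log 2 y.
Proof.
by move=> x0 xy; rewrite -trunc_log2_double //; apply: leq_trunc_log.
Qed.

Lemma leq_card_inj (T U : finType) (A : {set T}) (f : T -> U) :
  {in A &, injective f} -> #|A| <= #|U|.
Proof. by move=> fi; rewrite -(card_in_imset fi) max_card. Qed.

Section GraphBound.
Variables (m : nat) (P : {set 'I_m * 'I_m}).
Hypothesis Pfree : G1_free_graph P.

(* The disjunct [c == a] makes the predicate hold at the witness [a]. *)
Let last_nbr (a : 'I_m) : 'I_m :=
  [arg max_(c > a | (c == a) || ((a, c) \in P)) (c : nat)].
(** The default [last_nbr a] satisfies the predicate when [c < last_nbr a], the only case in which
    the minimum is used. *)
Let next_nbr (a c : 'I_m) : 'I_m :=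
  [arg min_(d < last_nbr a | ((a, d) \in P) && (c < d)) (d : nat)].

Let last_nbrP a c : (a, c) \in P -> (a, last_nbr a) \in P /\ c <= last_nbr a.
Proof.
move=> ac; rewrite /last_nbr; case: arg_maxnP => [|b /orP[/eqP->|ab] bmax].
- by rewrite eqxx.
- by have := bmax c; rewrite ac orbT => /(_ isT); have := Pfree.1 _ _ ac; lia.
- by split=> //; apply: bmax; rewrite ac orbT.
Qed.

Let next_nbrP a c : (a, c) \in P -> c < last_nbr a ->
  [/\ (a, next_nbr a c) \in P, c < next_nbr a c, next_nbr a c <= last_nbr a
    & forall d : 'I_m, (a, d) \in P -> c < d -> next_nbr a c <= d].
Proof.
move=> ac cl; have [al _] := last_nbrP ac; rewrite /next_nbr.
case: arg_minnP => [|d /andP[ad cd] dmin]; first by rewrite al.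
split=> //; first by apply: dmin; rewrite al.
by move=> e ae ce; apply: dmin; rewrite ae.
Qed.

Let gap_log (p : 'I_m * 'I_m) := trunc_log 2 (next_nbr p.1 p.2 - p.2).
Let tail_log (p : 'I_m * 'I_m) := trunc_log 2 (last_nbr p.1 - p.2).

Let trunc_log_lt (x : nat) : x <= m -> trunc_log 2 x < (trunc_log 2 m).+1.
Proof. by move=> xm; rewrite ltnS leq_trunc_log. Qed.

Let card_last : #|[set p in P | p.2 == last_nbr p.1]| <= m.
Proof.
rewrite -[leqRHS]card_ord; apply: (leq_card_inj (f := fst)).
move=> [a c] [b d]; rewrite !inE /= => /andP[_ /eqP->] /andP[_ /eqP->].
by move=> ->.
Qed.

Let short_gap (p : 'I_m * 'I_m) :=
  (next_nbr p.1 p.2 - p.2).*2 <= last_nbr p.1 - p.2.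

(* In a column [c], [next_nbr b c >= last_nbr a] whenever [a < b], so the
   short gaps at least double from one row to the next. *)
Let card_short_gap :
  #|[set p in P | (p.2 < last_nbr p.1) && short_gap p]|
    <= m * (trunc_log 2 m).+1.
Proof.
have E : #|{: 'I_m * 'I_(trunc_log 2 m).+1}| = m * (trunc_log 2 m).+1.
  by rewrite card_prod !card_ord.
rewrite -E; apply: (leq_card_inj (f := fun p => (p.2, inord (gap_log p)))).
have gap_le p : gap_log p < (trunc_log 2 m).+1.
  by apply: trunc_log_lt; have := ltn_ord (next_nbr p.1 p.2); lia.
have mono a b c : (a, c) \in P -> (b, c) \in P -> a < b ->
    c < last_nbr a -> c < last_nbr b -> short_gap (a, c) ->
    gap_log (a, c) < gap_log (b, c).
  move=> ac bc ab la lb; rewrite /short_gap /gap_log /= => sh.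
  have [an can _ _] := next_nbrP ac la.
  have [bn cbn _ _] := next_nbrP bc lb.
  have [al _] := last_nbrP ac.
  apply: trunc_log2_ltn; first by lia.
  (* If [next_nbr b c < last_nbr a], then rows [a < b] and columns [c < next_nbr b c < last_nbr a]
     carry a copy of [G1]. *)
  apply: leq_trans sh _; apply: leq_sub2r; rewrite leqNgt; apply/negP => lt.
  exact: Pfree.2 ab cbn lt ac al bc bn.
move=> [a c] [b d]; rewrite !inE /= => /and3P[ac la sa] /and3P[bd lb sb] [cd].
subst d; move=> /(congr1 val) /=; rewrite !inordK // => eg.
have [ab|ba|/ord_inj-> //] := ltngtP a b.
  by have := mono _ _ _ ac bd ab la lb sa; rewrite eg ltnn.
by have := mono _ _ _ bd ac ba lb la sb; rewrite eg ltnn.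
Qed.

(** After a long gap at [c], every later neighbour of [a] lies past more than half of the distance
    from [c] to [last_nbr a]. So [tail_log] strictly decreases along a row, and the row together
    with [tail_log] determines the edge. *)
Let card_long_gap :
  #|[set p in P | (p.2 < last_nbr p.1) && ~~ short_gap p]|
    <= m * (trunc_log 2 m).+1.
Proof.
have E : #|{: 'I_m * 'I_(trunc_log 2 m).+1}| = m * (trunc_log 2 m).+1.
  by rewrite card_prod !card_ord.
rewrite -E; apply: (leq_card_inj (f := fun p => (p.1, inord (tail_log p)))).
have tail_le p : tail_log p < (trunc_log 2 m).+1.
  by apply: trunc_log_lt; have := ltn_ord (last_nbr p.1); lia.
have mono a c d : (a, c) \in P -> (a, d) \in P -> c < d ->
    d < last_nbr a -> ~~ short_gap (a, c) ->
    tail_log (a, d) < tail_log (a, c).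
  move=> ac ad cd ld; rewrite /short_gap /tail_log /= -ltnNge => sh.
  have [_ _ _ /(_ _ ad cd) nd] := next_nbrP ac (ltn_trans cd ld).
  by apply: trunc_log2_ltn; lia.
move=> [a c] [b d]; rewrite !inE /= => /and3P[ac la sa] /and3P[bd lb sb] [ab].
subst b; move=> /(congr1 val) /=; rewrite !inordK // => eg.
have [cd|dc|/ord_inj-> //] := ltngtP c d.
  by have := mono _ _ _ ac bd cd lb sa; rewrite eg ltnn.
by have := mono _ _ _ bd ac dc la sb; rewrite eg ltnn.
Qed.

Lemma card_G1_free_graph : #|P| <= m * (2 * trunc_log 2 m + 3).
Proof.
have sub : P \subset [set p in P | p.2 == last_nbr p.1] :|:
   ([set p in P | (p.2 < last_nbr p.1) && short_gap p] :|:
    [set p in P | (p.2 < last_nbr p.1) && ~~ short_gap p]).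
  apply/fintype.subsetP => -[a c] ac; rewrite !inE ac /= -andb_orr orbN andbT.
  by have [_] := last_nbrP ac; rewrite leq_eqVlt.
apply: leq_trans (subset_leq_card sub) _.
apply: leq_trans (leq_card_setU _ _) _.
have -> : m * (2 * trunc_log 2 m + 3) =
  m + (m * (trunc_log 2 m).+1 + m * (trunc_log 2 m).+1) by lia.
apply: leq_add card_last _; apply: leq_trans (leq_card_setU _ _) _.
exact: leq_add card_short_gap card_long_gap.
Qed.

End GraphBound.

(** * Set families without [G1]: low and dense pairs *)

Definition G1_free_family (m : nat) (I : finType) (E : I -> {set 'I_m}) : Prop :=
  forall (a b c d e : 'I_m) (i j k l : I),
    a < b -> b < c -> c < d -> d < e -> uniq [:: i; j; k; l] ->
    a \in E i -> c \in E i -> a \in E j -> e \in E j ->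
    b \in E k -> c \in E k -> b \in E l -> d \in E l -> False.

Lemma avoid_seq (T : finType) (A : {set T}) (s : seq T) :
  size s < #|A| -> exists2 x, x \in A & x \notin s.
Proof.
move=> sA; apply/exists_inP; apply: contraLR sA.
rewrite negb_exists_in -leqNgt => /forall_inP As.
apply: leq_trans (card_size s); apply: subset_leq_card.
by apply/fintype.subsetP => x /As; rewrite negbK.
Qed.

Lemma card_bigcup_leq (J T : finType) (A : {set J}) (F : J -> {set T}) (k : nat) :
  {in A, forall j, #|F j| <= k} -> #|\bigcup_(j in A) F j| <= #|A| * k.
Proof.
move=> Fk; rewrite -sum_nat_const.
apply: (@leq_trans (\sum_(j in A) #|F j|)); last exact: leq_sum.
elim/big_rec2: _ => [|j s B _ IH]; first by rewrite cards0.
by apply: leq_trans (leq_card_setU _ _) _; rewrite leq_add2l.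
Qed.

Section FamilyBound.
Variables (m : nat) (I : finType) (E : I -> {set 'I_m}).
Hypotheses (E_inj : injective E) (E_neq0 : forall i, E i != finset.set0).
Hypothesis Efree : G1_free_family E.

Let owners (u v : 'I_m) : {set I} := [set i | (u \in E i) && (v \in E i)].
Let low u v := #|owners u v| < 4.
Let dense : {set 'I_m * 'I_m} := [set p : 'I_m * 'I_m | (p.1 < p.2) && ~~ low p.1 p.2].

(** Four owners per pair suffice: when an edge is chosen for the last of the four pairs, only three
    are already taken. *)
Let dense_free : G1_free_graph dense.
Proof.
split=> [u v|a b c d e ab cd de]; rewrite !inE /=; first by case/andP.
rewrite /low -!leqNgt => /andP[ac oac] /andP[_ oae] /andP[bc obc] /andP[_ obd].
have [i oi _] : exists2 i, i \in owners a c & i \notin [::].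
  by apply: avoid_seq => /=; lia.
have [j oj nj] : exists2 j, j \in owners a e & j \notin [:: i].
  by apply: avoid_seq => /=; lia.
have [k ok nk] : exists2 k, k \in owners b c & k \notin [:: j; i].
  by apply: avoid_seq => /=; lia.
have [l ol nl] : exists2 l, l \in owners b d & l \notin [:: k; j; i].
  by apply: avoid_seq => /=; lia.
have un : uniq [:: i; j; k; l].
  by rewrite -rev_uniq /rev /= nl nk nj.
move: oi oj ok ol; rewrite !inE.
move=> /andP[? ?] /andP[? ?] /andP[? ?] /andP[? ?].
by apply: (Efree ab bc cd de un).
Qed.

(** Otherwise these four pairs form a copy of [G1] in [dense]. *)
Let low_in_five (a b c d e : 'I_m) : a < b -> b < c -> c < d -> d < e ->
  [|| low a c, low a e, low b c | low b d].
Proof.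
move=> ab bc cd de; apply/negPn/negP; rewrite !negb_or => /and4P[ac ae nbc bd].
have in_dense (u v : 'I_m) : u < v -> ~~ low u v -> (u, v) \in dense.
  by move=> uv nuv; rewrite inE /= uv.
by apply: (dense_free.2 _ _ _ _ _ ab cd de); apply: in_dense => //; lia.
Qed.

(** The conjunct [p.1 < p.2] makes the relation irreflexive, so that [pairwise sep L] yields
    [uniq L]. *)
Let sep : rel ('I_m * 'I_m) := fun p q => (p.1 < p.2) && (p.2 < q.1).

Let ltI : rel 'I_m := fun u v => u < v.
Let ltI_trans : transitive ltI.
Proof. by move=> v u w; exact: ltn_trans. Qed.

(** The factor 9 is a block of five plus a remainder of at most four without low pairs, which is
    charged to the pair of the block. *)
Let low_choice (s : seq 'I_m) : Prop :=
  exists2 L : seq ('I_m * 'I_m),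
    [/\ forall p, p \in L -> [/\ p.1 < p.2, p.1 \in s, p.2 \in s & low p.1 p.2]
      & pairwise sep L]
    & size s <= 9 * size L
      \/ size s <= 4 /\ {in s &, forall u v : 'I_m, u < v -> ~~ low u v}.

(* A greedy choice of low pairs spanning disjoint intervals, one from each
   block of five consecutive elements. *)
Let low_pairs (s : seq 'I_m) : sorted ltI s -> low_choice s.
Proof.
have [n] := ubnP (size s); elim: n s => // n IHn s sn ss.
have small t : size t <= 4 -> low_choice t.
  move=> t4.
  case: (boolP [exists p : 'I_m * 'I_m,
    [&& p.1 < p.2, p.1 \in t, p.2 \in t & low p.1 p.2]]).
    move=> /existsP[p /and4P[? ? ? ?]]; exists [:: p]; last by left; rewrite /= muln1; apply: leq_trans t4 _.
    by split=> // q; rewrite inE => /eqP->.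
  rewrite negb_exists => /forallP nl; exists [::] => //; right.
  split=> // u v ut vt uv.
  by have := nl (u, v); rewrite /= uv ut vt.
case: s sn ss => [|a [|b [|c [|d [|e s]]]]] sn ss; try exact: small.
move: ss; rewrite /= (path_sortedE ltI_trans) => /and5P[ab bc cd de /andP[es ss]].
have /(_ _ ss)[|L [Lp Ld] Ls] := IHn s; first by move: sn => /=; lia.
have [p [p12 ps pl pe]] : exists p : 'I_m * 'I_m,
    [/\ p.1 < p.2, p.1 \in [:: a; b; c; d; e] /\ p.2 \in [:: a; b; c; d; e],
        low p.1 p.2 & p.2 <= e].
  move: ab bc cd de; rewrite /ltI => ab bc cd de.
  case/or4P: (low_in_five ab bc cd de) => lo;
    [exists (a, c)|exists (a, e)|exists (b, c)|exists (b, d)];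
    by split; rewrite //= ?inE ?eqxx ?orbT //; lia.
exists (p :: L); last first.
  by left; case: Ls => [h|[h _]] /=; clear - h; lia.
split=> [q|].
  have sub : {subset [:: a; b; c; d; e] <= [:: a, b, c, d, e & s]}.
    by move=> x xs; rewrite -[_ :: _]/([:: a; b; c; d; e] ++ s) mem_cat xs.
  rewrite inE => /orP[/eqP->|/Lp[? q1s q2s ?]].
    by split; [|apply: sub; case: ps|apply: sub; case: ps|].
  by split=> //; rewrite !inE ?q1s ?q2s !orbT.
rewrite /= Ld andbT; apply/allP => q /Lp[_ qs _ _].
by rewrite /sep p12; apply: leq_ltn_trans pe (allP es _ qs).
Qed.

Let sorted_enum (A : {set 'I_m}) : sorted ltI (enum A).
Proof.
rewrite {1}/enum_mem -enumT; apply: sorted_filter => //.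
by have := iota_ltn_sorted 0 m; rewrite -val_enum_ord sorted_map.
Qed.

Let common (p : 'I_m * 'I_m) : {set 'I_m} :=
  [set x : 'I_m | [&& p.2 < x, (p.1, x) \in dense & (p.2, x) \in dense]].

(** Three common right neighbours [c < d < e] of [a < b] would complete a copy of [G1] in
    [dense]. *)
Let card_common p : p \in dense -> #|common p| <= 2.
Proof.
case: p => a b; rewrite inE /= => /andP[ab _].
rewrite cardE; have := sorted_enum (common (a, b)).
have : {subset enum (common (a, b)) <= common (a, b)} by move=> x; rewrite mem_enum.
case: (enum _) => [|c [|d [|e s]]] // sub /= /and3P[cd de _].
have : c \in common (a, b) by apply: sub; rewrite !inE eqxx ?orbT.
have : d \in common (a, b) by apply: sub; rewrite !inE eqxx ?orbT.
have : e \in common (a, b) by apply: sub; rewrite !inE eqxx ?orbT.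
rewrite inE => /and3P[_ ae _]; rewrite inE => /and3P[_ _ bd].
rewrite inE => /and3P[_ ac bc].
by case: (dense_free.2 _ _ _ _ _ ab cd de ac ae bc bd).
Qed.

(** By injectivity of [E], sets may be counted instead of indices. The term [m] counts singletons;
    the factor 4 bounds the subsets of [common p], where [p] consists of the two least vertices of
    the clique. *)
Let card_cliques (K : {set I}) :
  (forall i, i \in K -> {in E i &, forall u v : 'I_m, u < v -> ~~ low u v}) ->
  #|K| <= m + #|dense| * 4.
Proof.
move=> Kc; rewrite -(card_imset _ E_inj).
set S1 := [set [set x] | x in 'I_m].
set S2 := \bigcup_(p in dense)
  [set [set p.1; p.2] :|: X | X : {set 'I_m} in powerset (common p)].
have sub : E @: K \subset S1 :|: S2.
  apply/fintype.subsetP => _ /imsetP[i iK ->]; rewrite inE.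
  have in_dense (u v : 'I_m) : u \in E i -> v \in E i -> u < v -> (u, v) \in dense.
    by move=> ui vi uv; rewrite inE /= uv (Kc i).
  have := sorted_enum (E i); have := set_enum (E i); have := mem_enum (E i).
  case: (enum _) => [|a [|b s]] Ei <-.
  - case/set0Pn: (E_neq0 i) => x; by rewrite -Ei.
  - move=> _; apply/orP; left; apply/imsetP; exists a => //.
    by apply/setP => x; rewrite !inE.
  rewrite /= (path_sortedE ltI_trans) => /andP[ab /andP[/allP bs _]].
  have Ea : a \in E i by rewrite -Ei !inE eqxx.
  have Eb : b \in E i by rewrite -Ei !inE eqxx orbT.
  have Es x : x \in s -> x \in E i by move=> xs; rewrite -Ei !inE xs !orbT.
  apply/orP; right; apply/finset.bigcupP; exists (a, b); first exact: in_dense.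
  apply/imsetP; exists [set x in s]; last by apply/setP => x; rewrite !inE /= orbA.
  rewrite powersetE; apply/fintype.subsetP => x; rewrite inE => xs.
  have bx : b < x := bs x xs.
  have Ex := Es x xs; have ax : a < x := ltn_trans ab bx.
  by rewrite inE /= bx !in_dense.
apply: leq_trans (subset_leq_card sub) _.
apply: leq_trans (leq_card_setU _ _) _; apply: leq_add.
  by apply: leq_trans (leq_imset_card _ _) _; rewrite card_ord.
apply: card_bigcup_leq => p /card_common pd.
apply: leq_trans (leq_imset_card _ _) _.
by rewrite card_powerset (@leq_exp2l 2 _ 2).
Qed.

Let pairwise_sep L p q : pairwise sep L -> p \in L -> q \in L ->
  [\/ p = q, p.2 < q.1 | q.2 < p.1].
Proof.
elim: L => // r L IH /=; rewrite !inE => /andP[/allP rL sL].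
case/orP=> [/eqP->|pL] /orP[/eqP->|qL]; first by constructor 1.
- by have /andP[_] := rL _ qL; constructor 2.
- by have /andP[_] := rL _ pL; constructor 3.
- exact: IH.
Qed.

(** With [x] the graph bound, the total is at most [9 * 3 * x] from the chosen low pairs and
    [4 * (m + 4 * x)] from the cliques, whence [43 = 27 + 16]. *)
Lemma incidences_G1_free_family :
  \sum_i #|E i| <= 43 * (m * (2 * trunc_log 2 m + 3)) + 4 * m.
Proof.
have [L Lp Ls] := fin_all_exists2 (fun i => low_pairs (sorted_enum (E i))).
pose P := [set p | [exists i, p \in L i]].
have LE i p : p \in L i -> [/\ p.1 < p.2, p.1 \in E i, p.2 \in E i & low p.1 p.2].
  by move=> pL; have [/(_ _ pL)] := Lp i; rewrite !mem_enum.
have Pfree : G1_free_graph P.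
  split=> [u v|a b c d e ab cd de]; rewrite !inE /=.
    by case/existsP=> i /LE[].
  case/existsP=> i iL /existsP[j jL] /existsP[k kL] /existsP[l lL].
  have [/= ac ai ci _] := LE _ _ iL; have [/= ae aj ej _] := LE _ _ jL.
  have [/= bc bk ck _] := LE _ _ kL; have [/= bd bl dl _] := LE _ _ lL.
  apply: (Efree ab bc cd de _ ai ci aj ej bk ck bl dl).
  rewrite /= !inE !negb_or andbT -!andbA.
  have ce := ltn_trans cd de.
  (* All four intervals of the copy contain [c], while distinct pairs chosen in one edge span
     disjoint intervals. *)
  have ne i1 i2 (p q : 'I_m * 'I_m) : p \in L i1 -> q \in L i2 -> p != q ->
      p.1 <= c <= p.2 -> q.1 <= c <= q.2 -> i1 != i2.
    move=> pL qL pq /andP[p1c cp2] /andP[q1c cq2].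
    apply/eqP => i12; subst i2; have [_ sL] := Lp i1.
    case: (pairwise_sep sL pL qL) => [/eqP|/=|/=]; first by rewrite (negbTE pq).
    - by rewrite ltnNge (leq_trans q1c cp2).
    - by rewrite ltnNge (leq_trans p1c cq2).
  have ltE (x y : 'I_m) : x < y -> (x == y) = false.
    by move=> xy; apply/negbTE; rewrite -val_eqE neq_ltn xy.
  have neI := (xpair_eqE, ltE _ _ ab, ltE _ _ cd, ltE _ _ de, ltE _ _ ce).
  have inI := (ltnW ac, ltnW bc, ltnW ce, ltnW cd, leqnn c).
  apply/and5P; split; [| | | |apply/andP; split].
  - by apply: ne iL jL _ _ _; rewrite ?neI ?andbF //= !inI.
  - by apply: ne iL kL _ _ _; rewrite ?neI ?andbF //= !inI.
  - by apply: ne iL lL _ _ _; rewrite ?neI ?andbF //= !inI.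
  - by apply: ne jL kL _ _ _; rewrite ?neI ?andbF //= !inI.
  - by apply: ne jL lL _ _ _; rewrite ?neI ?andbF //= !inI.
  - by apply: ne kL lL _ _ _; rewrite ?neI ?andbF //= !inI.
(* Double counting: a low pair has at most three owners, so it is chosen at most three times. *)
have sum_L : \sum_i size (L i) <= #|P| * 3.
  have sizeL i : size (L i) = \sum_(p in P) (p \in L i).
    have /card_uniqP <- : uniq (L i).
      have [_] := Lp i; apply: pairwise_uniq => p.
      by rewrite /sep; case: ltngtP.
    rewrite -sum1_card big_mkcond [RHS]big_mkcond; apply: eq_bigr => p _.
    rewrite inE; case: (boolP (p \in L i)) => [pL|_]; last by case: ifP.
    by rewrite (_ : [exists i, _]) //; apply/existsP; exists i.
  under eq_bigr do rewrite sizeL.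
  rewrite exchange_big /= -sum_nat_const; apply: leq_sum => p.
  rewrite inE => /existsP[j /LE[_ _ _ lowp]].
  rewrite -ltnS; apply: leq_ltn_trans lowp.
  rewrite -big_mkcond sum1_card; apply: subset_leq_card.
  by apply/fintype.subsetP => i /LE[_ p1 p2 _]; rewrite inE p1.
(* These edges fail the first alternative of [low_choice], hence are cliques of size at most
   four. *)
pose K := [set i | 9 * size (L i) < #|E i|].
have Kle i : i \in K -> #|E i| <= 4 /\
    {in E i &, forall u v : 'I_m, u < v -> ~~ low u v}.
  rewrite inE cardE => iK; case: (Ls i) => [|[E4 cl]]; first by rewrite leqNgt iK.
  by split=> // u v ui vi; apply: cl; rewrite mem_enum.
have cK : #|K| <= m + #|dense| * 4 by apply: card_cliques => i /Kle[].
have Esum : \sum_i #|E i| <= \sum_i (9 * size (L i) + 4 * (i \in K)).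
  apply: leq_sum => i _; case: (boolP (i \in K)) => [/Kle[E4 _]|].
    by rewrite muln1; apply: leq_trans E4 _; rewrite leq_addl.
  by rewrite inE -leqNgt muln0 addn0.
have K4 : \sum_i (i \in K : nat) = #|K| by rewrite -big_mkcond sum1_card.
apply: leq_trans Esum _; rewrite big_split /= -!big_distrr /= K4.
have := card_G1_free_graph Pfree; have := card_G1_free_graph dense_free.
move: cK sum_L.
move: (m * (_ + _)) #|K| #|P| #|dense| (\sum_i size (L i)) => x k p d z.
clear; lia.
Qed.

End FamilyBound.

(** * From hypergraphs to set families *)

Lemma edge_neq0 (H : hypergraph) (i : 'I_(nedges H)) : edge i != fset0.
Proof.
by apply: contraNneq (edges_neq0 H) => <-; apply: mem_nth.
Qed.

Lemma mem_vertices_G1 (v : nat) : (v \in vertices G1) = (0 < v <= 5).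
Proof.
rewrite /vertices /= /G1_edges !big_cons big_nil !inE.
by case: v => [|[|[|[|[|[|v]]]]]].
Qed.

Lemma contains_G1 (H : hypergraph) (x : nat -> nat)
    (i j k l : 'I_(nedges H)) :
  x 1 < x 2 -> x 2 < x 3 -> x 3 < x 4 -> x 4 < x 5 -> uniq [:: i; j; k; l] ->
  x 1 \in edge i -> x 3 \in edge i -> x 1 \in edge j -> x 5 \in edge j ->
  x 2 \in edge k -> x 3 \in edge k -> x 2 \in edge l -> x 4 \in edge l ->
  contains H G1.
Proof.
move=> x12 x23 x34 x45 ijkl i1 i3 j1 j5 k2 k3 l2 l4.
exists x, (fun t => nth i [:: i; j; k; l] t); split.
- move=> v; rewrite mem_vertices_G1.
  case: v => [|[|[|[|[|[|v]]]]]] // _; apply: (fsubsetP (edge_sub_vertices _));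
  eassumption.
- have x13 := ltn_trans x12 x23; have x24 := ltn_trans x23 x34.
  have x35 := ltn_trans x34 x45; have x14 := ltn_trans x13 x34.
  have x25 := ltn_trans x24 x45; have x15 := ltn_trans x14 x45.
  move=> u v; rewrite !mem_vertices_G1.
  by case: u => [|[|[|[|[|[|u]]]]]] //; case: v => [|[|[|[|[|[|v]]]]]] // _ _ _.
- move=> s t /eqP; rewrite nth_uniq //; first by move/eqP/val_inj.
- by move=> t v; case: t => [[|[|[|[|]]]] lt] //; rewrite /edge /= !inE => /orP[] /eqP->.
Qed.

(** The increasing enumeration [x] of the vertices pulls the edges back to distinct nonempty subsets
    of ['I_m]; since [x] is increasing, a copy of [G1] among these would give one in [H]. *)
Lemma nincidences_avoider (H : hypergraph) (n : nat) : avoiders G1 n H ->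
  nincidences H <= 43 * (n * (2 * trunc_log 2 n + 3)) + 4 * n.
Proof.
case=> nH sH vH; pose m := nvertices H; pose s := sort leq (vertices H).
have size_s : size s = m by rewrite size_sort.
have s_sorted : sorted ltn s.
  by rewrite ltn_sorted_uniq_leq sort_uniq fset_uniq sort_sorted //; exact: leq_total.
pose x (u : 'I_m) := nth 0 s u.
have x_lt (u v : 'I_m) : u < v -> x u < x v.
  by move=> uv; apply: (sorted_ltn_nth ltn_trans); rewrite ?inE ?size_s.
have x_inj : injective x.
  move=> u v xuv; apply: val_inj; case: (ltngtP u v) => // /x_lt;
    by rewrite xuv ltnn.
have x_surj (i : 'I_(nedges H)) y : y \in edge i -> exists u, y = x u.
  move=> /(fsubsetP (edge_sub_vertices _)); rewrite -(mem_sort leq) -/s => ys.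
  have ym : index y s < m by rewrite -size_s index_mem.
  by exists (Ordinal ym); rewrite /x nth_index.
pose E (i : 'I_(nedges H)) := [set u : 'I_m | x u \in edge i]%SET.
have card_E i : #|E i| = #|` edge i|.
  rewrite cardE -(size_map x); apply: perm_size; apply: uniq_perm.
  - by rewrite map_inj_uniq ?enum_uniq.
  - exact: fset_uniq.
  move=> y; apply/mapP/idP => [[u]|yi].
    by rewrite mem_enum inE => ui ->.
  by have [u yu] := x_surj _ _ yi; exists u; rewrite // mem_enum inE -yu.
have E_inj : injective E.
  have sub i j : E i = E j -> (edge i `<=` edge j)%fset.
    move=> /setP Eij; apply/fsubsetP => y yi; have [u yu] := x_surj _ _ yi.
    by have := Eij u; rewrite !inE -yu yi => <-.
  by move=> i j Eij; apply: sH; apply/eqP; rewrite eqEfsubset !sub.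
have E_neq0 i : E i != finset.set0.
  have /fset0Pn[y yi] := edge_neq0 i; have [u yu] := x_surj _ _ yi.
  by apply/set0Pn; exists u; rewrite inE -yu.
have E_free : G1_free_family E.
  move=> a b c d e i j k l ab bc cd de ijkl; rewrite !inE => *; apply: nH.
  (* The leading 0 shifts the list so that positions 1 to 5 match the vertices of [G1]. *)
  by apply: (@contains_G1 _ (nth 0 [:: 0; x a; x b; x c; x d; x e]) i j k l);
    rewrite //=; exact: x_lt.
rewrite /nincidences -(eq_bigr _ (fun i _ => card_E i)).
apply: leq_trans (incidences_G1_free_family E_inj E_neq0 E_free) _.
apply: leq_add; last by rewrite leq_mul2l vH orbT.
apply: leq_mul => //; apply: leq_mul => //; rewrite leq_add2r leq_mul2l.
exact: leq_trunc_log.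
Qed.

Lemma nedges_le_nincidences (H : hypergraph) : nedges H <= nincidences H.
Proof.
rewrite -[leqLHS]card_ord -sum1_card; apply: leq_sum => i _.
by rewrite cardfs_gt0 edge_neq0.
Qed.

Lemma ex_e_le_ex_i (F : hypergraph) (n : nat) :
  0 < nedges F -> ex_e F n <= ex_i F n.
Proof.
move=> F0; have [[H HF <-] _] := ex_eP n F0; have [_ max_i] := ex_iP n F0.
by apply: leq_trans (nedges_le_nincidences H) _; apply: max_i; exists H.
Qed.

Lemma ex_i_G1_upper (n : nat) :
  ex_i G1 n <= 43 * (n * (2 * trunc_log 2 n + 3)) + 4 * n.
Proof.
by have [[H HF <-] _] := @ex_iP G1 n isT; apply: nincidences_avoider.
Qed.

(** * The construction by powers of two *)

Section LowerBound.
Variable m : nat.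
Let L := trunc_log 2 m.

Let pow_edge (j k : nat) : {fset nat} := [fset (j + 2 ^ k)%N; (m + j)%N]%fset.
(** For [k < L], [2 ^ k] is at most half of [m], so [j < uphalf m] keeps every row below [m], and no
    [(j, k)] has to be discarded. *)
Let pow_edges : seq {fset nat} :=
  [seq pow_edge j k | j <- iota 0 (uphalf m), k <- iota 0 L].

Let pow_bound j k : j < uphalf m -> k < L -> j + 2 ^ k < m.
Proof.
move=> jm kL; have m0 : 0 < m by case: (m) jm.
have : 2 ^ k.+1 <= m.
  by apply: (@leq_trans (2 ^ L)); [rewrite leq_exp2l|apply: trunc_logP].
by move: jm; rewrite uphalf_half expnS; have := odd_double_half m; lia.
Qed.

Let pow_edgesP A : A \in pow_edges ->
  exists j k, [/\ j < uphalf m, k < L, j + 2 ^ k < m & A = pow_edge j k].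
Proof.
case/allpairsP => -[j k] [/=]; rewrite !mem_iota !add0n /= => jm kL ->.
by exists j, k; split=> //; apply: pow_bound.
Qed.

Let pow_edges_neq0 : fset0%fset \notin pow_edges.
Proof.
apply/negP => /pow_edgesP[j [k [_ _ _ /fsetP/(_ (m + j))]]].
by rewrite !inE eqxx orbT.
Qed.

Let H := Hypergraph pow_edges_neq0.

(** Rows lie below [m] and columns do not, so the columns must agree, giving [j], and then the rows,
    giving [k]. *)
Let pow_edge_inj j k j' k' : j + 2 ^ k < m -> j' + 2 ^ k' < m ->
  pow_edge j k = pow_edge j' k' -> (j, k) = (j', k').
Proof.
move=> lt lt' /fsetP eqE.
have := eqE (m + j); have := eqE (j + 2 ^ k); rewrite !inE !eqxx orbT /=.
move=> /esym/orP e1 /esym/orP e2.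
have jj : j = j' by case: e2 => /eqP; lia.
have /eqP : 2 ^ k = 2 ^ k' by case: e1 => /eqP; lia.
by rewrite eqn_exp2l // => /eqP ->; rewrite jj.
Qed.

Let H_simple : simple H.
Proof.
have U : uniq (edges H).
  apply: allpairs_uniq; rewrite ?iota_uniq //.
  move=> _ _ /allpairsP[[j k] [/= jm kL ->]] /allpairsP[[j' k'] [/= jm' kL' ->]] /=.
  move: jm kL jm' kL'; rewrite !mem_iota !add0n /= => jm kL jm' kL'.
  by apply: pow_edge_inj; apply: pow_bound.
by move=> i j /eqP; rewrite nth_uniq // => /eqP/val_inj.
Qed.

Let H_vertices : nvertices H <= m.*2.
Proof.
rewrite -(size_iota 0 m.*2); apply: uniq_leq_size; first exact: fset_uniq.
move=> y /bigfcupP[A /andP[/pow_edgesP[j [k [jm kL lt ->]]] _]].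
rewrite !inE mem_iota; have : j < m by lia.
by move=> ? /orP[] /eqP->; lia.
Qed.

Let H_edge (i : 'I_(nedges H)) y z : y \in edge i -> z \in edge i -> y < z ->
  exists j k, y = j + 2 ^ k /\ z = m + j.
Proof.
have /pow_edgesP[j [k [_ _ lt ->]]] : edge i \in pow_edges by exact: mem_nth.
rewrite !inE => /orP[] /eqP-> /orP[] /eqP->; try lia.
by exists j, k.
Qed.

(** In a copy, [x 1 = j + 2 ^ p] and [x 2 = j + 2 ^ r] share the column [x 3 = m + j]. The columns
    [x 4 = m + j''] and [x 5 = m + j'] satisfy [j'' = j + 2 ^ r - 2 ^ s] and [j'' < j' < x 1], so
    [2 ^ r < 2 ^ p + 2 ^ s]. But [x 1 < x 2] gives [p < r] and [x 3 < x 4] gives [s < r], so the sum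
    is at most [2 ^ r]. *)
Let H_G1_free : ~ contains H G1.
Proof.
case=> x [f [_ x_lt _ xE]].
have lt12 : x 1 < x 2 by apply: x_lt; rewrite ?mem_vertices_G1.
have lt23 : x 2 < x 3 by apply: x_lt; rewrite ?mem_vertices_G1.
have lt34 : x 3 < x 4 by apply: x_lt; rewrite ?mem_vertices_G1.
have lt45 : x 4 < x 5 by apply: x_lt; rewrite ?mem_vertices_G1.
have mem t v (t4 : t < 4) : v \in nth fset0 G1_edges t -> x v \in edge (f (Ordinal t4)).
  by move=> vt; apply: xE.
have [j [p [x1 x3]]] : exists j p, x 1 = j + 2 ^ p /\ x 3 = m + j.
  by apply: (@H_edge (f (@Ordinal 4 0 isT))); rewrite ?mem ?inE //; lia.
have [j' [q [x1' x5]]] : exists j p, x 1 = j + 2 ^ p /\ x 5 = m + j.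
  by apply: (@H_edge (f (@Ordinal 4 1 isT))); rewrite ?mem ?inE //; lia.
have [j3 [r [x2 x3']]] : exists j p, x 2 = j + 2 ^ p /\ x 3 = m + j.
  by apply: (@H_edge (f (@Ordinal 4 2 isT))); rewrite ?mem ?inE //; lia.
have [j'' [s [x2' x4]]] : exists j p, x 2 = j + 2 ^ p /\ x 4 = m + j.
  by apply: (@H_edge (f (@Ordinal 4 3 isT))); rewrite ?mem ?inE //; lia.
have j3E : j3 = j by lia.
have pr : p < r by rewrite -(@ltn_exp2l 2) //; lia.
have sr : s < r by rewrite -(@ltn_exp2l 2) //; lia.
have : 2 ^ p.+1 <= 2 ^ r by rewrite leq_exp2l.
have : 2 ^ s.+1 <= 2 ^ r by rewrite leq_exp2l.
have : 0 < 2 ^ q by rewrite expn_gt0.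
by rewrite !expnS; lia.
Qed.

Lemma ex_e_G1_lower_double : uphalf m * trunc_log 2 m <= ex_e G1 m.*2.
Proof.
have [_ max_e] := @ex_eP G1 m.*2 isT; apply: max_e; exists H; first by split.
by rewrite /nedges /= size_allpairs !size_iota.
Qed.

End LowerBound.

Lemma ex_e_mono (F : hypergraph) (n n' : nat) :
  0 < nedges F -> n <= n' -> ex_e F n <= ex_e F n'.
Proof.
move=> F0 nn; have [[H [H1 H2 H3] <-] _] := ex_eP n F0; have [_ max_e] := ex_eP n' F0.
by apply: max_e; exists H => //; split=> //; apply: leq_trans nn.
Qed.

Lemma ex_e_G1_lower (n : nat) :
  uphalf n./2 * trunc_log 2 n./2 <= ex_e G1 n.
Proof.
apply: leq_trans (ex_e_G1_lower_double _) _; apply: ex_e_mono => //.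
by have := odd_double_half n; lia.
Qed.

(** * Logarithms and the asymptotic statements *)

Lemma near_ln_ge (R : realType) (c : R) :
  (\forall n \near \oo%classic, c <= ln (n%:R : R))%R.
Proof.
exists (Num.trunc (expR c)).+1 => // n /= cn.
have cn' : (expR c <= n%:R :> R)%R.
  by apply: le_trans (ltW (truncnS_gt _)) _; rewrite ler_nat.
have n0 : (0 < n%:R :> R)%R by apply: lt_le_trans cn'; exact: expR_gt0.
by rewrite -ler_expR lnK.
Qed.

Lemma trunc_log2_le_ln (R : realType) (n : nat) : 0 < n ->
  ((trunc_log 2 n)%:R * ln 2 <= ln n%:R :> R)%R.
Proof.
move=> n0; rewrite mulr_natl -lnXn //; rewrite ler_ln ?posrE ?exprn_gt0 ?ltr0n //.
by rewrite -natrX ler_nat trunc_logP.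
Qed.

Lemma ln_le_trunc_log2 (R : realType) (n : nat) : 0 < n ->
  (ln n%:R <= (trunc_log 2 n).+1%:R * ln 2 :> R)%R.
Proof.
move=> n0; rewrite mulr_natl -lnXn //; rewrite ler_ln ?posrE ?exprn_gt0 ?ltr0n //.
by rewrite -natrX ler_nat ltnW // trunc_log_ltn.
Qed.

Local Open Scope ring_scope.

Lemma nlogn_ll_ex_e_G1 (R : realType) :
  (fun n : nat => n%:R * ln n%:R : R) <<_oo (fun n : nat => (ex_e G1 n)%:R).
Proof.
have ln2 : 0 < ln 2 :> R by rewrite ln_gt0 // ltr1n.
(* [18 = 6 * 3] comes from [n_le] and [ln_le]; the added 1 makes the inequality strict, as
   [ex_e G1 n] is positive. *)
exists (18 * ln 2 + 1); first by rewrite addr_gt0 // mulr_gt0.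
(* From 4 on, [m >= 2] and so [t >= 1], which lets [t + 2] be bounded by [3 * t]. *)
exists 4%N => // n /= n4.
set m := n./2; set t := trunc_log 2 m.
have nm : (n <= m.*2.+1)%N by rewrite /m; have := odd_double_half n; lia.
have m2 : (2 <= m)%N by lia.
have t1 : (0 < t)%N by rewrite trunc_log_gt0.
have tn : trunc_log 2 n = t.+1 by rewrite trunc_log2S //; lia.
have n_le : n%:R <= 6 * (uphalf m)%:R :> R.
  by rewrite -natrM ler_nat; rewrite uphalf_half; have := odd_double_half m; lia.
have ln_le : ln n%:R <= 3 * t%:R * ln 2 :> R.
  apply: le_trans (ln_le_trunc_log2 _ _) _; first by lia.
  by rewrite ler_pM2r // tn -natrM ler_nat; lia.
have ex_ge : (uphalf m)%:R * t%:R <= (ex_e G1 n)%:R :> R.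
  by rewrite -natrM ler_nat ex_e_G1_lower.
have um : 1 <= (uphalf m)%:R :> R.
  by rewrite ler1n uphalf_half; have := odd_double_half m; lia.
have t1R : 1 <= t%:R :> R by rewrite ler1n.
have ln0 : 0 <= ln n%:R :> R by rewrite ln_ge0 // ler1n; lia.
rewrite ger0_norm ?mulr_ge0 // ger0_norm //.
apply: le_lt_trans (ler_pM _ ln0 n_le ln_le) _ => //.
have -> : 6 * (uphalf m)%:R * (3 * t%:R * ln 2) =
  18 * ln 2 * ((uphalf m)%:R * t%:R) :> R by ring.
rewrite [ltRHS]mulrDl mul1r -[ltLHS]addr0; apply: ler_ltD.
  by rewrite ler_pM2l // mulr_gt0.
by apply: lt_le_trans ex_ge; nra.
Qed.

Lemma ex_i_G1_ll (R : realType) :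
  (fun n : nat => (ex_i G1 n)%:R)
    <<_oo (fun n : nat => n%:R * ln n%:R ^+ 2 * ln (ln n%:R) ^+ 3 : R).
Proof.
have ln2 : 0 < ln 2 :> R by rewrite ln_gt0 // ltr1n.
have C0 : 0 < 86 / ln 2 + 134 :> R by rewrite addr_gt0 // divr_gt0.
(* Here [86 = 43 * 2] and [133 = 43 * 3 + 4]; one more gives strictness. *)
exists (86 / ln 2 + 134) => //; near=> n.
have n1 : (0 < n)%N by near: n; exists 1%N.
(* This makes both [ln n] and [ln (ln n)] at least 1. *)
have l1 : expR 1 <= ln n%:R :> R by near: n; exact: near_ln_ge.
set x := ln n%:R in l1 *.
have x1 : 1 <= x by apply: le_trans l1; rewrite -[leLHS]expR0 ler_expR.
have y1 : 1 <= ln x by rewrite -ler_expR lnK // posrE (lt_le_trans _ x1).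
have lg : (trunc_log 2 n)%:R <= x / ln 2.
  by rewrite ler_pdivlMr // trunc_log2_le_ln.
have n1R : 1 <= n%:R :> R by rewrite ler1n.
have x0 : 0 <= x by apply: le_trans x1.
have up : (ex_i G1 n)%:R <= n%:R * (86 * (trunc_log 2 n)%:R + 133) :> R.
  rewrite -!natrM -natrD -natrM ler_nat; apply: leq_trans (ex_i_G1_upper n) _.
  by lia.
rewrite ger0_norm // ger0_norm; last first.
  apply: mulr_ge0; first by rewrite mulr_ge0 // exprn_ge0.
  by rewrite exprn_ge0 //; apply: le_trans y1.
apply: le_lt_trans up _.
have y3 : 1 <= ln x ^+ 3 by rewrite exprn_ege1.
(* The bound obtained is of order [n * ln n]; the remaining factors of the target are at least 1. *)
have xx : x <= x ^+ 2 * ln x ^+ 3.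
  apply: (@le_trans _ _ (x ^+ 2)); first by rewrite expr2 ler_peMl.
  by rewrite ler_peMr // exprn_ge0.
rewrite -mulrA mulrCA ltr_pM2l ?(lt_le_trans _ n1R) //.
apply: (@lt_le_trans _ _ ((86 / ln 2 + 134) * x)); last by rewrite ler_pM2l.
rewrite [ltRHS]mulrDl; apply: ler_ltD; last by lra.
by rewrite -mulrA ler_pM2l // mulrC.
Unshelve. all: by end_near. Qed.

Lemma ll_monol (R : realType) (f g h : nat -> R) :
  (forall n, `|f n| <= `|g n|) -> g <<_oo h -> f <<_oo h.
Proof.
move=> fg [c c0 gh]; exists c => //; near=> n.
by apply: le_lt_trans (fg n) _; near: n.
Unshelve. all: by end_near. Qed.

Lemma ll_monor (R : realType) (f g h : nat -> R) :
  (forall n, `|g n| <= `|h n|) -> f <<_oo g -> f <<_oo h.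
Proof.
move=> gh [c c0 fg]; exists c => //; near=> n.
apply: (@lt_le_trans _ _ (c * `|g n|)); first by near: n.
by rewrite ler_pM2l.
Unshelve. all: by end_near. Qed.

Theorem theorem3 (R : realType) :
  (((fun n : nat => n%:R * ln n%:R : R) <<_oo (fun n : nat => (ex_e G1 n)%:R))
   /\
   ((fun n : nat => (ex_e G1 n)%:R)
      <<_oo (fun n : nat => n%:R * ln n%:R ^+ 2 * ln (ln n%:R) ^+ 3 : R)))
  /\
  (((fun n : nat => n%:R * ln n%:R : R) <<_oo (fun n : nat => (ex_i G1 n)%:R))
   /\
   ((fun n : nat => (ex_i G1 n)%:R)
      <<_oo (fun n : nat => n%:R * ln n%:R ^+ 2 * ln (ln n%:R) ^+ 3 : R))).
Proof.
(* Edges are nonempty, so the lower bound for [ex_e] and the upper bound for [ex_i] yield the other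
   two. *)
have e_le_i n : `|(ex_e G1 n)%:R| <= `|(ex_i G1 n)%:R| :> R.
  by rewrite !normr_nat ler_nat ex_e_le_ex_i.
split; split.
- exact: nlogn_ll_ex_e_G1.
- exact: ll_monol e_le_i (ex_i_G1_ll R).
- exact: ll_monor e_le_i (nlogn_ll_ex_e_G1 R).
- exact: ex_i_G1_ll.
Qed.
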